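(* Let $J$ be a hereditary family of subsets of a countable set $\mathrm{dom}(J)$ with $\mathrm{dom}(J)\notin J$. Then $Q(J)$ does not add Cohen reals if and only if $J\restriction a\not\geq_K\mathtt{NWD}$ for every $J$-positive set $a\subseteq\mathrm{dom}(J)$.
   Context: $J$ hereditary means $a\subseteq b\in J\Rightarrow a\in J$; $a$ is $J$-positive if $a\notin J$; $J\restriction a=\{b\subseteq a: b\in J\}$. $Q(J)$ is the poset of trees $T\subseteq\mathrm{dom}(J)^{<\omega}$ such that every $t\in T$ has an extension $s\in T$ with $\{y: s^\frown y\in T\}\notin J$, ordered by inclusion. For hereditary families $H,F$ on countable sets, $H\geq_K F$ (Katětov) if there is $f:\mathrm{dom}(H)\to\mathrm{dom}(F)$ with $f^{-1}(a)\in H$ for every $a\in F$. $\mathtt{NWD}$ is the ideal on $2^{<\omega}$ of nowhere dense sets: $a\subseteq 2^{<\omega}$ is nowhere dense if every finite binary sequence has an extension no further extension of which lies in $a$. *)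

(* Defs.v *)
From Stdlib Require Import List Arith.
Import ListNotations.
Set Implicit Arguments.

(** Families of subsets of a type [X]; [dom J] is the whole type [X]. *)
Definition hereditary {X : Type} (J : (X -> Prop) -> Prop) : Prop :=
  forall a b : X -> Prop, (forall x, a x -> b x) -> J b -> J a.

Definition countable_type (X : Type) : Prop :=
  exists f : X -> nat, forall x y, f x = f y -> x = y.

Definition is_prefix {A : Type} (s t : list A) : Prop := exists u, t = s ++ u.

Definition restr {X : Type} (J : (X -> Prop) -> Prop) (a : X -> Prop)
  : ({x : X | a x} -> Prop) -> Prop :=
  fun c => J (fun x => exists h : a x, c (exist _ x h)).

Definition katetov_ge {A B : Type} (H : (A -> Prop) -> Prop)
  (F : (B -> Prop) -> Prop) : Prop :=
  exists f : A -> B, forall b : B -> Prop, F b -> H (fun x => b (f x)).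

Definition nowhere_dense (a : list bool -> Prop) : Prop :=
  forall s, exists t, is_prefix s t /\ forall u, is_prefix t u -> ~ a u.

Definition NWD : (list bool -> Prop) -> Prop := nowhere_dense.

Definition is_tree {X : Type} (T : list X -> Prop) : Prop :=
  T nil /\ forall s t, is_prefix s t -> T t -> T s.

Definition QJ_cond {X : Type} (J : (X -> Prop) -> Prop) (T : list X -> Prop)
  : Prop :=
  is_tree T /\
  forall t, T t -> exists s, is_prefix t s /\ T s /\
                             ~ J (fun y => T (s ++ [y])).

Definition QJ {X : Type} (J : (X -> Prop) -> Prop) : Type :=
  {T : list X -> Prop | QJ_cond J T}.

(** ordered by inclusion (stronger condition = smaller tree) *)
Definition QJ_le {X : Type} (J : (X -> Prop) -> Prop) (p q : QJ J) : Prop :=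
  forall s, proj1_sig p s -> proj1_sig q s.

(** Forcing with a poset (P, le), le p q meaning "p is stronger than q".
    A (nice) name for a subset of omega x 2 is [nm : nat -> bool -> P -> Prop],
    nm n i being the set of conditions q with ((n,i), q) in the name. *)
Definition dense_below {P : Type} (le : P -> P -> Prop) (p : P)
  (D : P -> Prop) : Prop :=
  forall q, le q p -> exists r, le r q /\ D r.

Definition forces_val {P : Type} (le : P -> P -> Prop)
  (nm : nat -> bool -> P -> Prop) (q : P) (n : nat) (i : bool) : Prop :=
  dense_below le q (fun r => exists r', nm n i r' /\ le r r').

Definition forces_real {P : Type} (le : P -> P -> Prop) (p : P)
  (nm : nat -> bool -> P -> Prop) : Prop :=
  forall n,
    dense_below le p
      (fun r => forces_val le nm r n false \/ forces_val le nm r n true) /\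
    (forall r, le r p -> ~ (forces_val le nm r n false /\ forces_val le nm r n true)).

Definition forces_init {P : Type} (le : P -> P -> Prop)
  (nm : nat -> bool -> P -> Prop) (r : P) (s : list bool) : Prop :=
  forall n, n < length s -> forces_val le nm r n (nth n s false).

Definition cohen_dense (D : list bool -> Prop) : Prop :=
  forall s, exists t, is_prefix s t /\ D t.

(** p ||- "x is Cohen generic over V": x meets every ground-model dense set *)
Definition forces_cohen {P : Type} (le : P -> P -> Prop) (p : P)
  (nm : nat -> bool -> P -> Prop) : Prop :=
  forall D, cohen_dense D ->
    dense_below le p (fun r => exists s, D s /\ forces_init le nm r s).

Definition adds_cohen_real (P : Type) (le : P -> P -> Prop) : Prop :=
  exists (p : P) (nm : nat -> bool -> P -> Prop),
    forces_real le p nm /\ forces_cohen le p nm.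

(* Main.v *)
(** If [f : a -> 2^<w] witnesses Katetov-reducibility, then below the condition [a^<w]
    the concatenation of the [f]-values along the generic branch is Cohen: at a split node,
    the successors [y] for which appending [f y] misses a given open dense set form the
    preimage of a nowhere dense set, so they do not exhaust the positive successor set.

    Conversely, suppose that no such reduction exists.  Below a split node [s], choose for
    each successor [y] a condition through [s ++ [y]] deciding an initial segment [f y] of
    the real, with [f y] of length [code y].  Since [f] is not a Katetov reduction, the
    successors can be thinned, staying positive, so that the values [f y] are nowhere dense.
    Hence every [w] extends to some [w'] that is excluded beyond all but finitely many
    [y], and the finitely many exceptions are removed one at a time by deciding one more
    bit of the real and lengthening [w'].  A fusion of these steps gives a condition below
    which the real avoids an open dense set. *)
Require Import Defs.
From Stdlib Require Import List Arith.
From Stdlib Require Import Lia Cantor ClassicalEpsilon.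
Import ListNotations.

(** * Initial segments of finite sequences *)

Lemma prefix_refl {A} (s : list A) : is_prefix s s.
Proof. exists nil; now rewrite app_nil_r. Qed.

Lemma prefix_nil {A} (s : list A) : is_prefix nil s.
Proof. now exists s. Qed.

Lemma prefix_app {A} (s t : list A) : is_prefix s (s ++ t).
Proof. now exists t. Qed.

Lemma prefix_trans {A} (s t u : list A) :
  is_prefix s t -> is_prefix t u -> is_prefix s u.
Proof. intros [v ->] [w ->]; exists (v ++ w); now rewrite app_assoc. Qed.

Lemma prefix_length {A} (s t : list A) : is_prefix s t -> length s <= length t.
Proof. intros [u ->]; rewrite length_app; lia. Qed.

Lemma prefix_length_eq {A} (s t : list A) :
  is_prefix s t -> length t <= length s -> s = t.
Proof.
  intros [u ->]; rewrite length_app; destruct u; simpl; [|lia].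
  now rewrite app_nil_r.
Qed.

Lemma prefix_total {A} (s t u : list A) :
  is_prefix s u -> is_prefix t u -> is_prefix s t \/ is_prefix t s.
Proof.
  revert t u; induction s as [|x s IH]; intros t u [v Hv] [w Hw].
  - left; apply prefix_nil.
  - destruct t as [|y t]; [right; apply prefix_nil|].
    rewrite Hv in Hw; injection Hw as <- E.
    destruct (IH t (s ++ v)) as [[z ->]|[z ->]].
    + apply prefix_app.
    + now exists w.
    + left; now exists z.
    + right; now exists z.
Qed.

Lemma prefix_snoc {A} (u s : list A) (y : A) :
  is_prefix u (s ++ [y]) -> is_prefix u s \/ u = s ++ [y].
Proof.
  intros H; destruct (prefix_total u s (s ++ [y]) H (prefix_app _ _)) as [|[w ->]]; auto.
  destruct w as [|z w]; [left; rewrite app_nil_r; apply prefix_refl|].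
  right; apply prefix_length_eq; auto.
  rewrite !length_app; simpl; lia.
Qed.

Lemma prefix_nth {A} (d : A) (s t : list A) n :
  is_prefix s t -> n < length s -> nth n t d = nth n s d.
Proof. intros [u ->] Hn; now rewrite app_nth1. Qed.

Lemma prefix_of_nth {A} (d : A) (s t : list A) :
  length s <= length t -> (forall n, n < length s -> nth n s d = nth n t d) ->
  is_prefix s t.
Proof.
  revert t; induction s as [|x s IH]; intros t Hl Hn; [apply prefix_nil|].
  destruct t as [|y t]; simpl in Hl; [lia|].
  destruct (IH t) as [u ->]; [lia| |].
  - intros n Hlt; apply (Hn (S n)); simpl; lia.
  - exists u; simpl; f_equal; symmetry; apply (Hn 0); simpl; lia.
Qed.

(** * Countability and dependent choice *)

Lemma countable_list (X : Type) : countable_type X -> countable_type (list X).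
Proof.
  intros [f Hf].
  exists (fix code l := match l with nil => 0 | x :: l => S (to_nat (f x, code l)) end).
  intros l; induction l as [|x l IH]; intros [|y l'] E; try discriminate; auto.
  apply eq_add_S, to_nat_inj in E; injection E as E1 E2; f_equal; auto.
Qed.

Lemma countable_bool : countable_type bool.
Proof. exists (fun b : bool => if b then 0 else 1); now intros [] []. Qed.

Lemma finitely_many_below {X} (f : X -> nat) (Hf : forall x y, f x = f y -> x = y) N :
  exists l, forall x, f x < N -> In x l.
Proof.
  induction N as [|N [l Hl]]; [exists nil; lia|].
  destruct (classic (exists x, f x = N)) as [[x0 E]|H].
  - exists (x0 :: l); intros x Hx.
    destruct (Nat.eq_dec (f x) N); [left; apply Hf; congruence|].
    right; apply Hl; lia.
  - exists l; intros x Hx; apply Hl.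
    assert (f x <> N) by eauto; lia.
Qed.

Lemma dependent_choice_nat {S : Type} (R : nat -> S -> S -> Prop) (s0 : S) :
  (forall n s, exists s', R n s s') ->
  exists st : nat -> S, st 0 = s0 /\ forall n, R n (st n) (st (Datatypes.S n)).
Proof.
  intros H.
  destruct (choice (fun (p : nat * S) s' => R (fst p) (snd p) s')) as [g Hg].
  { intros [n s]; apply H. }
  exists (nat_rect _ s0 (fun n s => g (n, s))); split; auto.
  intros n; apply (Hg (n, _)).
Qed.

(** * Deciding initial segments of a named real *)

Section Names.
Context {P : Type} {le : P -> P -> Prop}.
Hypothesis le_refl : forall p, le p p.
Hypothesis le_trans : forall p q r, le p q -> le q r -> le p r.
Context {p : P} {nm : nat -> bool -> P -> Prop} (Hreal : forces_real le p nm).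

Lemma forces_init_stronger q r s :
  le r q -> forces_init le nm q s -> forces_init le nm r s.
Proof. intros Hr H n Hn u Hu; apply (H n Hn); eauto. Qed.

Lemma forces_init_prefix q s t :
  is_prefix s t -> forces_init le nm q t -> forces_init le nm q s.
Proof.
  intros Hp H n Hn; rewrite <- (prefix_nth false s t n Hp Hn); apply H.
  apply prefix_length in Hp; lia.
Qed.

Lemma forces_init_snoc q s i :
  forces_init le nm q (s ++ [i]) <->
  forces_init le nm q s /\ forces_val le nm q (length s) i.
Proof.
  split.
  - intros H; split.
    + apply (forces_init_prefix _ _ _ (prefix_app s [i]) H).
    + specialize (H (length s)); rewrite nth_middle in H; apply H.
      rewrite length_app; simpl; lia.
  - intros [H1 H2] n Hn; rewrite length_app in Hn; simpl in Hn.
    destruct (Nat.eq_dec n (length s)) as [->|Hne]; [now rewrite nth_middle|].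
    rewrite app_nth1 by lia; apply H1; lia.
Qed.

Lemma forces_val_unique q n i j :
  le q p -> forces_val le nm q n i -> forces_val le nm q n j -> i = j.
Proof.
  intros Hq Hi Hj; destruct (Hreal n) as [_ H]; specialize (H q Hq).
  destruct i, j; auto; tauto.
Qed.

Lemma decide_val q n : le q p -> exists r i, le r q /\ forces_val le nm r n i.
Proof.
  intros Hq; destruct (Hreal n) as [H _].
  destruct (H q Hq) as (r & Hr & [Hv|Hv]); eauto.
Qed.

Lemma decide_init q n : le q p ->
  exists r s, le r q /\ length s = n /\ forces_init le nm r s.
Proof.
  intros Hq; induction n as [|n (r & s & Hr & Hl & Hs)].
  - exists q, nil; repeat split; auto; intros n Hn; simpl in Hn; lia.
  - destruct (decide_val r n) as (r' & i & Hr' & Hv); [eauto|].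
    exists r', (s ++ [i]); split; [eauto|split].
    + rewrite length_app; simpl; lia.
    + apply forces_init_snoc; rewrite Hl; split; auto.
      now apply (forces_init_stronger r).
Qed.

Lemma forces_init_comparable q s t : le q p -> length s <= length t ->
  forces_init le nm q s -> forces_init le nm q t -> is_prefix s t.
Proof.
  intros Hq Hl Hs Ht; apply (prefix_of_nth false); auto.
  intros n Hn; apply (forces_val_unique q n); auto; apply Ht; lia.
Qed.

End Names.

(** * Restricting and gluing trees of $Q(J)$ *)

Section Conditions.
Context {X : Type} (J : (X -> Prop) -> Prop) (HJ : hereditary J).

Lemma QJ_le_refl (q : QJ J) : QJ_le q q.
Proof. now intros s. Qed.

Lemma QJ_le_trans (q r s : QJ J) : QJ_le q r -> QJ_le r s -> QJ_le q s.
Proof. intros H1 H2 u Hu; auto. Qed.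

Lemma QJ_nil (q : QJ J) : proj1_sig q nil.
Proof. apply (proj2_sig q). Qed.

Lemma QJ_prefix (q : QJ J) s t : is_prefix s t -> proj1_sig q t -> proj1_sig q s.
Proof. apply (proj2_sig q). Qed.

Lemma QJ_split (q : QJ J) t : proj1_sig q t ->
  exists s, is_prefix t s /\ proj1_sig q s /\ ~ J (fun y => proj1_sig q (s ++ [y])).
Proof. apply (proj2_sig q). Qed.

Lemma positive_mono (a b : X -> Prop) : (forall x, a x -> b x) -> ~ J a -> ~ J b.
Proof. intros H Ha Hb; exact (Ha (HJ _ _ H Hb)). Qed.

(** A node comparable with [t] splits inside [r], whose successor sets can only grow in [q'].
    Extensions of an incomparable node never enter the cone of [t], so it splits as in [q]. *)
Lemma replace_cone (q r : QJ J) t : QJ_le r q -> proj1_sig r t ->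
  exists q' : QJ J, forall u,
    proj1_sig q' u <-> proj1_sig q u /\ (is_prefix t u -> proj1_sig r u).
Proof.
  intros Hle Ht.
  assert (Hc : QJ_cond J (fun u => proj1_sig q u /\ (is_prefix t u -> proj1_sig r u))).
  2: { exists (exist _ _ Hc); simpl; tauto. }
  split; [split|].
  - split; [apply QJ_nil|intros; apply QJ_nil].
  - intros u v Huv [Hv Hv']; split; [now apply (QJ_prefix q u v)|].
    intros Htu; apply (QJ_prefix r u v Huv), Hv'; eauto using prefix_trans.
  - intros u [Hu Hu'].
    assert (in_r : proj1_sig r u -> exists s, is_prefix u s /\
      (proj1_sig q s /\ (is_prefix t s -> proj1_sig r s)) /\
      ~ J (fun y => proj1_sig q (s ++ [y]) /\
                    (is_prefix t (s ++ [y]) -> proj1_sig r (s ++ [y])))).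
    { intros Hru; destruct (QJ_split r u Hru) as (s & H1 & H2 & H3).
      exists s; split; [auto|split; [auto|]].
      revert H3; apply positive_mono; auto. }
    destruct (classic (is_prefix t u)) as [Htu|Htu]; auto.
    destruct (classic (is_prefix u t)) as [Hut|Hut].
    { apply in_r, (QJ_prefix r u t); auto. }
    assert (Hinc : forall v, is_prefix u v -> ~ is_prefix t v).
    { intros v H1 H2; destruct (prefix_total u t v); auto. }
    destruct (QJ_split q u Hu) as (s & H1 & H2 & H3).
    exists s; split; [auto|split; [split; auto|]].
    + intros H; now apply Hinc in H.
    + revert H3; apply positive_mono; intros y Hy; split; auto.
      intros H; apply Hinc in H; [easy|].
      eapply prefix_trans; [apply H1|apply prefix_app].
Qed.

(** The stem leads to [s], which splits because [a] is positive; beyond [s ++ [y]] the splitting is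
    that of [r y]. *)
Lemma amalgamate (s : list X) (a : X -> Prop) (r : X -> QJ J) :
  ~ J a -> (forall y, a y -> proj1_sig (r y) (s ++ [y])) ->
  exists q : QJ J, forall u, proj1_sig q u <->
    is_prefix u s \/ exists y, a y /\ is_prefix (s ++ [y]) u /\ proj1_sig (r y) u.
Proof.
  intros Ha Hr.
  assert (Hc : QJ_cond J (fun u => is_prefix u s \/
    exists y, a y /\ is_prefix (s ++ [y]) u /\ proj1_sig (r y) u)).
  2: { exists (exist _ _ Hc); simpl; tauto. }
  split; [split|].
  - left; apply prefix_nil.
  - intros u v Huv [Hv|(y & Hy & Hs & Hv)]; [left; eauto using prefix_trans|].
    destruct (prefix_total u (s ++ [y]) v) as [H|H]; auto.
    + apply prefix_snoc in H as [H|H]; [now left|].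
      right; exists y; subst; auto using prefix_refl.
    + right; exists y; repeat split; auto; now apply (QJ_prefix (r y) u v).
  - intros u [Hu|(y & Hy & Hs & Hu)].
    + exists s; split; [auto|split; [left; apply prefix_refl|]].
      revert Ha; apply positive_mono; intros y Hy.
      right; exists y; auto using prefix_refl.
    + destruct (QJ_split (r y) u Hu) as (v & H1 & H2 & H3).
      exists v; split; [auto|split].
      * right; exists y; eauto using prefix_trans.
      * revert H3; apply positive_mono; intros z Hz.
        right; exists y; repeat split; auto.
        apply (prefix_trans _ u); auto.
        apply (prefix_trans _ v); auto using prefix_app.
Qed.

Lemma cone_exists (q : QJ J) t : proj1_sig q t ->
  exists r : QJ J, QJ_le r q /\ proj1_sig r t /\
    forall u, proj1_sig r u -> is_prefix u t \/ is_prefix t u.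
Proof.
  intros Ht.
  assert (Hc : QJ_cond J (fun u => proj1_sig q u /\ (is_prefix u t \/ is_prefix t u))).
  2: { exists (exist _ _ Hc); repeat split; simpl; auto using prefix_refl; try tauto.
       intros u Hu; apply Hu. }
  split; [split|].
  - split; [apply QJ_nil|left; apply prefix_nil].
  - intros u v Huv [Hv [H|H]]; (split; [now apply (QJ_prefix q u v)|]).
    + left; eauto using prefix_trans.
    + apply (prefix_total _ _ v); auto.
  - intros u [Hu H].
    assert (exists w, is_prefix u w /\ is_prefix t w /\ proj1_sig q w)
      as (w & Hw1 & Hw2 & Hw3).
    { destruct H; [exists t|exists u]; auto using prefix_refl. }
    destruct (QJ_split q w Hw3) as (s & H1 & H2 & H3).
    exists s; split; [eauto using prefix_trans|split].
    + split; eauto using prefix_trans.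
    + revert H3; apply positive_mono; intros y Hy; split; auto.
      right; apply (prefix_trans _ w); auto.
      apply (prefix_trans _ s); auto using prefix_app.
Qed.

Section Leafless.
Hypothesis J_empty : J (fun _ => False).

Lemma positive_inhabited (a : X -> Prop) : ~ J a -> exists x, a x.
Proof.
  intros Ha; apply NNPP; intros H; apply Ha.
  apply (HJ _ _ (fun x Hx => H (ex_intro _ x Hx)) J_empty).
Qed.

(** With the empty set in [J], positive successor sets are inhabited, so no node is maximal. *)
Lemma QJ_long (q : QJ J) t n : proj1_sig q t ->
  exists u, is_prefix t u /\ proj1_sig q u /\ n <= length u.
Proof.
  intros Ht; induction n as [|n (u & H1 & H2 & H3)].
  - exists t; repeat split; auto using prefix_refl; lia.
  - destruct (QJ_split q u H2) as (s & H4 & _ & H5).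
    apply positive_inhabited in H5 as [y Hy].
    exists (s ++ [y]); split; [|split; auto].
    + apply (prefix_trans _ u); auto; apply (prefix_trans _ s); auto using prefix_app.
    + apply prefix_length in H4; rewrite length_app; simpl; lia.
Qed.

(** Some node of [q] is at least as long as [t] and comparable with it. Hence strengthening a cone
    at [t] never loses [t]. *)
Lemma cone_mem (q : QJ J) t :
  (forall u, proj1_sig q u -> is_prefix u t \/ is_prefix t u) -> proj1_sig q t.
Proof.
  intros H; destruct (QJ_long q nil (length t) (QJ_nil q)) as (u & _ & Hu & Hl).
  destruct (H u Hu) as [H'|H']; [|now apply (QJ_prefix q t u)].
  now rewrite <- (prefix_length_eq u t).
Qed.

End Leafless.
End Conditions.

Section CohenReals.
Context {X : Type} (J : (X -> Prop) -> Prop) (HJ : hereditary J).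

(** * From a Katetov reduction to a Cohen real *)

Section CohenBranch.
Context (a : X -> Prop) (F : X -> list bool) (Ha : ~ J a).
Hypothesis HF : forall b, nowhere_dense b -> J (fun x => a x /\ b (F x)).

(** One split node [s] suffices: the words that miss [E] when appended to the concatenation along
    [s] form a nowhere dense set, so the positive successor set of [s] is not contained in its
    preimage. *)
Lemma branch_meets (q : QJ J) (E : list bool -> Prop) :
  (forall s x, proj1_sig q s -> In x s -> a x) ->
  (forall s, exists t, is_prefix s t /\ forall u, is_prefix t u -> E u) ->
  exists s, proj1_sig q s /\ E (flat_map F s).
Proof.
  intros Hq HE.
  destruct (QJ_split J q nil (QJ_nil J q)) as (s & _ & Hs & Hpos).
  assert (Hb : nowhere_dense (fun t => ~ E (flat_map F s ++ t))).
  { intros t; destruct (HE (flat_map F s ++ t)) as (t' & [w ->] & H).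
    exists (t ++ w); split; [apply prefix_app|].
    intros u [v ->] Hn; apply Hn, H; exists v; now rewrite !app_assoc. }
  apply NNPP; intros Hno; apply Hpos.
  refine (HJ _ _ _ (HF _ Hb)); intros y Hy; split.
  - apply (Hq (s ++ [y])); auto; apply in_elt.
  - intros HEy; apply Hno; exists (s ++ [y]); split; auto.
    now rewrite flat_map_app; simpl; rewrite app_nil_r.
Qed.

(* The name of the real obtained by concatenating the [F]-values along the generic branch. *)
Definition branch_name (n : nat) (i : bool) (q : QJ J) : Prop :=
  exists s, (forall u, proj1_sig q u -> is_prefix u s \/ is_prefix s u) /\
            nth_error (flat_map F s) n = Some i.

Lemma branch_forces (q : QJ J) s n i :
  (forall u, proj1_sig q u -> is_prefix u s \/ is_prefix s u) ->
  nth_error (flat_map F s) n = Some i -> forces_val (@QJ_le X J) branch_name q n i.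
Proof.
  intros Hq Hn r Hr; exists r; split; [apply QJ_le_refl|].
  exists q; split; auto; now exists s.
Qed.

Lemma nth_error_flat_map_prefix s t n i : is_prefix s t ->
  nth_error (flat_map F s) n = Some i -> nth_error (flat_map F t) n = Some i.
Proof.
  intros [u ->] H; rewrite flat_map_app, nth_error_app1; auto.
  apply nth_error_Some; congruence.
Qed.

Lemma katetov_adds_cohen : @adds_cohen_real (QJ J) (@QJ_le X J).
Proof.
  (* The empty set is nowhere dense, so its preimage is in [J]; [cone_mem] relies on this. *)
  assert (J_empty : J (fun _ => False)).
  { assert (Hb : nowhere_dense (fun _ => False)).
    { intros s; exists s; split; auto using prefix_refl. }
    refine (HJ _ _ _ (HF _ Hb)); tauto. }
  assert (Hp : QJ_cond J (fun s => forall x, In x s -> a x)).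
  { split; [split|].
    - intros x [].
    - intros s t [u ->] H x Hx; apply H, in_or_app; auto.
    - intros t Ht; exists t; split; [apply prefix_refl|split; auto].
      revert Ha; apply positive_mono; auto.
      intros y Hy x Hx; apply in_app_or in Hx as [Hx|[<-|[]]]; auto. }
  exists (exist _ _ Hp), branch_name; split.
  - intros n; split.
    + intros q Hq.
      destruct (branch_meets q (fun u => n < length u)) as (s & Hs & Hl).
      { intros s x Hs; apply (Hq s Hs). }
      { intros s; exists (s ++ repeat false (S n)); split; [apply prefix_app|].
        intros u Hu; apply prefix_length in Hu.
        rewrite length_app, repeat_length in Hu; lia. }
      destruct (cone_exists J HJ q s Hs) as (r & Hr & _ & Hc).
      exists r; split; auto.
      destruct (nth_error (flat_map F s) n) as [i|] eqn:E.
      * destruct i; [right|left]; now apply (branch_forces r s).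
      * apply nth_error_None in E; lia.
    + intros r _ [Hf Ht].
      destruct (Hf r (QJ_le_refl J r)) as (r1 & Hr1 & q1 & (s1 & Hs1 & E1) & Hq1).
      destruct (Ht r1 Hr1) as (r2 & Hr2 & q2 & (s2 & Hs2 & E2) & Hq2).
      (* As [r2] lies below both [q1] and [q2], the stems [s1] and [s2] are comparable, and
         concatenations along comparable stems agree wherever both are defined. *)
      assert (M1 : proj1_sig r2 s1).
      { apply cone_mem; auto; intros u Hu; apply Hs1; auto. }
      destruct (Hs2 s1 (Hq2 s1 M1)) as [H|H].
      * apply (nth_error_flat_map_prefix _ _ _ _ H) in E1; congruence.
      * apply (nth_error_flat_map_prefix _ _ _ _ H) in E2; congruence.
  - intros D HD q Hq.
    destruct (branch_meets q (fun u => exists d, D d /\ is_prefix d u))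
      as (s & Hs & d & Hd & Hds).
    { intros s x Hs; apply (Hq s Hs). }
    { intros s; destruct (HD s) as (t & Ht & HDt); exists t; split; eauto. }
    destruct (cone_exists J HJ q s Hs) as (r & Hr & _ & Hc).
    exists r; split; auto; exists d; split; auto.
    intros n Hn; apply (branch_forces r s); auto.
    rewrite <- (prefix_nth false _ _ _ Hds Hn); apply nth_error_nth'.
    apply prefix_length in Hds; lia.
Qed.

End CohenBranch.

(** * Exits from a finite set of fixed nodes *)

(* [q] restricted to the nodes comparable with [t] forces that [w] is not an
   initial segment of the real. *)
Definition avoids (nm : nat -> bool -> QJ J -> Prop) (q : QJ J) (t : list X)
  (w : list bool) : Prop :=
  forall u, QJ_le u q -> proj1_sig u t -> ~ forces_init (@QJ_le X J) nm u w.

Definition covered (F : list (list X)) (t : list X) : Prop :=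
  exists s, In s F /\ is_prefix t s.

(** The cones at these minimal uncovered nodes are where the condition may still change. For empty
    [F] the root is the only one. *)
Definition exit_node (F : list (list X)) (t : list X) : Prop :=
  ~ covered F t /\ forall u, is_prefix u t -> u <> t -> covered F u.

Lemma exit_below F t : ~ covered F t -> exists e, is_prefix e t /\ exit_node F e.
Proof.
  induction t as [|x t IH] using rev_ind; intros H.
  - exists nil; split; [apply prefix_refl|split; auto].
    intros u [v Hv]; symmetry in Hv; now apply app_eq_nil in Hv as [-> _].
  - destruct (classic (covered F t)) as [Ht|Ht].
    + exists (t ++ [x]); split; [apply prefix_refl|split; auto].
      intros u Hu Hne; apply prefix_snoc in Hu as [Hu|]; [|easy].
      destruct Ht as (s & Hs & Hts); exists s; eauto using prefix_trans.
    + destruct (IH Ht) as (e & He & Hex); exists e; split; auto.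
      apply (prefix_trans _ t); auto using prefix_app.
Qed.

Lemma covered_length F : exists n, forall t, covered F t -> length t <= n.
Proof.
  induction F as [|s F [n Hn]].
  - exists 0; intros t (s & [] & _).
  - exists (length s + n); intros t (s' & [<-|Hs'] & Ht).
    + apply prefix_length in Ht; lia.
    + assert (length t <= n) by (apply Hn; exists s'; auto); lia.
Qed.

(* [F] is the set of nodes whose successors stay fixed in the rest of the fusion. *)
Definition refines (F : list (list X)) (q' q : QJ J) : Prop :=
  QJ_le q' q /\
  forall s y, In s F -> proj1_sig q (s ++ [y]) -> proj1_sig q' (s ++ [y]).

Lemma refines_refl F q : refines F q q.
Proof. split; auto; apply QJ_le_refl. Qed.

Lemma refines_le F q' q : refines F q' q -> QJ_le q' q.
Proof. now intros []. Qed.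

Lemma refines_trans F q r s : refines F q r -> refines F r s -> refines F q s.
Proof. intros [H1 H2] [H3 H4]; split; eauto using QJ_le_trans. Qed.

(** An exit [t] is not an initial segment of a member of [F], so a successor of a fixed node lies in
    the cone of [t] only if it is [t] itself, which [r] keeps. *)
Lemma refines_replace F (q q' r : QJ J) t : exit_node F t -> proj1_sig r t ->
  (forall u, proj1_sig q' u <-> proj1_sig q u /\ (is_prefix t u -> proj1_sig r u)) ->
  refines F q' q.
Proof.
  intros [Ht _] Hr Hq'; split; [intros u; rewrite Hq'; tauto|].
  intros s y Hs Hy; rewrite Hq'; split; auto; intros Hp.
  apply prefix_snoc in Hp as [Hp|<-]; auto.
  destruct Ht; now exists s.
Qed.

(** * Fusion in the absence of Katetov reductions *)

Section Fusion.
Hypothesis J_empty : J (fun _ => False).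
Context (code : X -> nat) (code_inj : forall x y, code x = code y -> x = y).
Context (p : QJ J) (nm : nat -> bool -> QJ J -> Prop).
Hypothesis Hreal : forces_real (@QJ_le X J) p nm.
Hypothesis not_katetov : forall a, ~ J a -> ~ katetov_ge (restr J a) NWD.

Lemma avoids_mono q q' t t' w w' :
  QJ_le q' q -> is_prefix t t' -> is_prefix w w' ->
  avoids nm q t w -> avoids nm q' t' w'.
Proof.
  intros Hq Ht Hw H u Hu Hut Hf; apply (H u).
  - eauto using QJ_le_trans.
  - now apply (QJ_prefix J u t t').
  - now apply (forces_init_prefix _ w w').
Qed.

(** A condition below [q] through [t], cut down to the nodes comparable with [t], lies below [r] and
    still forces what it did. *)
Lemma avoids_of_cone q r t w : proj1_sig r t ->
  (forall u, proj1_sig q u -> is_prefix t u -> proj1_sig r u) ->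
  avoids nm r t w -> avoids nm q t w.
Proof.
  intros Ht Hqr Hr u Huq Hut Hf.
  destruct (cone_exists J HJ u t Hut) as (c & Hc & Hct & Hcone).
  apply (Hr c); auto.
  - intros v Hv; destruct (Hcone v Hv).
    + now apply (QJ_prefix J r v t).
    + apply Hqr; auto.
  - apply (forces_init_stronger (@QJ_le_trans X J) u); auto.
Qed.

Lemma avoids_of_forces q w w' : QJ_le q p ->
  forces_init (@QJ_le X J) nm q w' -> length w <= length w' -> ~ is_prefix w w' ->
  avoids nm q nil w.
Proof.
  intros Hq Hf Hl Hn u Hu _ Hfu; apply Hn.
  apply (forces_init_comparable Hreal u); eauto using QJ_le_trans.
  apply (forces_init_stronger (@QJ_le_trans X J) q); auto.
Qed.

(* The invariant of the fusion: every open set of reals has an open subset that is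
   avoided beyond all but finitely many exits. *)
Definition good (q : QJ J) (F : list (list X)) : Prop :=
  forall w, exists w' L, is_prefix w w' /\
    forall t, exit_node F t -> ~ In t L -> avoids nm q t w'.

Lemma good_mono q q' F : QJ_le q' q -> good q F -> good q' F.
Proof.
  intros Hq H w; destruct (H w) as (w' & L & Hw & HL); exists w', L; split; auto.
  intros t Ht HtL; apply (avoids_mono q q' t t w' w'); auto using prefix_refl.
Qed.

(** One exit is treated at a time: the next bit is decided in its cone and the opposite bit is
    appended to the word. Lengthening the word preserves avoidance at the exits already treated. *)
Lemma clear_exits F L q w : QJ_le q p ->
  exists q' w', refines F q' q /\ is_prefix w w' /\
    forall t, In t L -> exit_node F t -> avoids nm q' t w'.
Proof.
  intros Hq; induction L as [|t L (q1 & w1 & Hq1 & Hw1 & HL)].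
  - exists q, w; split; [apply refines_refl|split; [apply prefix_refl|intros t []]].
  - destruct (classic (exit_node F t /\ proj1_sig q1 t)) as [[Ht Hq1t]|Hno].
    (* An exit that is not a node of [q1] is avoided vacuously. *)
    2: { exists q1, w1; split; [auto|split; auto].
         intros t' [<-|Ht'] Hex; auto.
         intros u Hu Hut; destruct Hno; auto. }
    destruct (cone_exists J HJ q1 t Hq1t) as (c & Hc & _ & Hcone).
    assert (Hcp : QJ_le c p) by eauto 6 using QJ_le_trans, refines_le.
    destruct (decide_val Hreal c (length w1) Hcp) as (r & i & Hr & Hv).
    assert (Hrt : proj1_sig r t) by (apply cone_mem; auto).
    destruct (replace_cone J HJ q1 r t) as (q' & Hq'); eauto using QJ_le_trans.
    assert (Href : refines F q' q1) by now apply (refines_replace F q1 q' r t).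
    exists q', (w1 ++ [negb i]); split; [|split].
    + eauto using refines_trans.
    + eauto using prefix_trans, prefix_app.
    + intros t' [<-|Ht'] Hex.
      * apply (avoids_of_cone q' r); auto; [intros u Hu; now apply Hq'|].
        intros u Hu _ Hf; apply forces_init_snoc in Hf as [_ Hf].
        assert (E : i = negb i); [|now destruct i].
        apply (forces_val_unique Hreal u (length w1)); auto.
        -- eauto using QJ_le_trans.
        -- intros v Hvu; apply Hv; eauto using QJ_le_trans.
      * apply (avoids_mono q1 q' t' t' w1); auto using prefix_refl, prefix_app.
        apply Href.
Qed.

(** Covered nodes have bounded length, so every stronger condition passes through an exit; [good]
    handles those outside the finite list and [clear_exits] those in it. *)
Lemma avoid_step q F w : QJ_le q p -> good q F ->
  exists q' w', refines F q' q /\ is_prefix w w' /\ avoids nm q' nil w'.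
Proof.
  intros Hq Hg; destruct (Hg w) as (w0 & L & Hw0 & HL).
  destruct (clear_exits F L q w0 Hq) as (q' & w' & Href & Hw' & HL').
  exists q', w'; split; [auto|split; [eauto using prefix_trans|]].
  intros u Hu _ Hf.
  destruct (covered_length F) as [n Hn].
  destruct (QJ_long J HJ J_empty u nil (S n) (QJ_nil J u)) as (v & _ & Hv & Hlen).
  destruct (exit_below F v) as (e & Hev & He).
  { intros Hc; apply Hn in Hc; lia. }
  assert (Hue : proj1_sig u e) by now apply (QJ_prefix J u e v).
  destruct (classic (In e L)) as [HeL|HeL].
  - now apply (HL' e HeL He u).
  - apply (avoids_mono q q' e e w0 w') in HL; auto using prefix_refl; [|apply Href].
    now apply (HL u).
Qed.

Lemma nwd_thinning (a : X -> Prop) (f : X -> list bool) : ~ J a ->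
  exists b, nowhere_dense b /\ ~ J (fun x => a x /\ b (f x)).
Proof.
  intros Ha; apply NNPP; intros Hno; apply (not_katetov a Ha).
  exists (fun x => f (proj1_sig x)); intros b Hb; apply NNPP; intros Hn.
  apply Hno; exists b; split; auto; intros Hj; apply Hn.
  refine (HJ _ _ _ Hj); intros x [h Hx]; auto.
Qed.

(** One node of the fusion is served: unless it is already covered or gone, a split node above [t]
    becomes fixed, and the invariant survives at the new exits because the words decided there lie
    in a nowhere dense set. *)
Lemma split_step q F t : QJ_le q p -> good q F ->
  (forall s, In s F -> ~ J (fun y => proj1_sig q (s ++ [y]))) ->
  exists q' F', refines F q' q /\ incl F F' /\ good q' F' /\
    (forall s, In s F' -> ~ J (fun y => proj1_sig q' (s ++ [y]))) /\
    (proj1_sig q' t -> covered F' t).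
Proof.
  intros Hq Hg HF.
  destruct (classic (proj1_sig q t /\ ~ covered F t)) as [[Ht Hcov]|Hno].
  2: { exists q, F; split; [apply refines_refl|].
       split; [apply incl_refl|split; [auto|split; auto]].
       intros Ht; apply NNPP; tauto. }
  (* The whole cone at [e], not only that at [t], is thinned: this leaves a single stem from [e] to
     [s], so the only new exits in the tree are successors of [s]. *)
  destruct (exit_below F t Hcov) as (e & Het & He).
  destruct (QJ_split J q t Ht) as (s & Hts & Hs & Hpos).
  assert (Hes : is_prefix e s) by eauto using prefix_trans.
  (* The lower bound [code y] on the length leaves only finitely many successors
     with a short decided part. *)
  assert (Hdec : forall y, exists rw : QJ J * list bool, proj1_sig q (s ++ [y]) ->
    QJ_le (fst rw) q /\ proj1_sig (fst rw) (s ++ [y]) /\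
    length (snd rw) = code y /\ forces_init (@QJ_le X J) nm (fst rw) (snd rw)).
  { intros y; destruct (classic (proj1_sig q (s ++ [y]))) as [Hy|Hy].
    2: { exists (q, nil); tauto. }
    destruct (cone_exists J HJ q _ Hy) as (c & Hc & _ & Hcone).
    destruct (decide_init (@QJ_le_refl X J) (@QJ_le_trans X J) Hreal c (code y))
      as (r & w & Hr & Hl & Hf); [eauto using QJ_le_trans|].
    exists (r, w); intros _; simpl; split; [eauto using QJ_le_trans|].
    split; auto; apply cone_mem; auto. }
  apply choice in Hdec as [rw Hrw].
  destruct (nwd_thinning _ (fun y => snd (rw y)) Hpos) as (b & Hb & Hpos').
  destruct (amalgamate J HJ s _ (fun y => fst (rw y)) Hpos') as (r & Hr).
  { intros y [Hy _]; now apply Hrw. }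
  assert (Hrq : QJ_le r q).
  { intros u Hu; apply Hr in Hu as [Hu|(y & [Hy _] & _ & Hu)].
    - now apply (QJ_prefix J q u s).
    - now apply (Hrw y Hy). }
  assert (Hre : proj1_sig r e) by (apply Hr; auto).
  destruct (replace_cone J HJ q r e Hrq Hre) as (q' & Hq').
  assert (Href : refines F q' q) by now apply (refines_replace F q q' r e).
  exists q', (s :: F); split; [auto|split; [|split; [|split]]].
  - now right.
  - intros w; destruct (Hg w) as (w0 & L & Hw0 & HL).
    destruct (Hb w0) as (w' & Hw' & Hbw').
    (* No extension of [w'] is in [b]. The new exceptions are the successors whose decided word, of
       length [code y], is shorter than [w']. *)
    destruct (finitely_many_below code code_inj (length w')) as (l & Hl).
    exists w', (L ++ map (fun y => s ++ [y]) l).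
    split; [eauto using prefix_trans|].
    intros x [Hx Hx'] HxL u Hu Hux.
    assert (Hqx : proj1_sig q' x) by auto.
    destruct (classic (is_prefix e x)) as [Hex|Hex].
    + apply Hq' in Hqx as [_ Hrx]; specialize (Hrx Hex).
      apply Hr in Hrx as [Hxs|(y & [Hy Hby] & Hyx & _)].
      { destruct Hx; exists s; split; [now left|auto]. }
      (* Were [x] a proper extension, [s ++ [y]] would be covered by [s], which is too short, or by
         a node of [F], which would then cover [e]. *)
      assert (Ex : s ++ [y] = x).
      { apply NNPP; intros Hne.
        destruct (Hx' _ Hyx Hne) as (s' & [<-|Hs'] & Hss').
        - apply prefix_length in Hss'; rewrite length_app in Hss'; simpl in Hss'; lia.
        - apply (proj1 He); exists s'; split; auto.
          apply (prefix_trans _ s); auto.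
          apply (prefix_trans _ (s ++ [y])); auto using prefix_app. }
      destruct (Hrw y Hy) as (Hle & Hmem & Hlen & Hf).
      assert (Hlong : length w' <= code y).
      { apply Nat.le_ngt; intros Hlt; apply HxL, in_or_app; right.
        rewrite <- Ex; apply (in_map (fun y => s ++ [y])); auto. }
      (* The word decided at [y] is in [b], so it does not extend [w']; being at least as long, it
         contradicts [w']. *)
      assert (Hav : avoids nm (fst (rw y)) nil w').
      { apply (avoids_of_forces _ w' (snd (rw y))); eauto using QJ_le_trans; [lia|].
        intros Hp; now apply (Hbw' _ Hp). }
      apply (avoids_mono _ (fst (rw y)) nil x w' w') in Hav;
        auto using QJ_le_refl, prefix_nil, prefix_refl.
      revert u Hu Hux; fold (avoids nm q' x w').
      apply (avoids_of_cone q' (fst (rw y))); auto; [now rewrite <- Ex|].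
      intros v Hv Hxv; apply Hq' in Hv as [_ Hv].
      assert (Hrv : proj1_sig r v) by eauto using prefix_trans.
      apply Hr in Hrv as [Hvs|(z & [Hz _] & Hzv & Hv')].
      * assert (Hxs := prefix_length _ _ (prefix_trans _ _ _ Hxv Hvs)).
        rewrite <- Ex, length_app in Hxs; simpl in Hxs; lia.
      * assert (Ez : s ++ [y] = s ++ [z]).
        { rewrite <- Ex in Hxv.
          destruct (prefix_total _ _ _ Hxv Hzv) as [H|H];
            apply prefix_length_eq in H; auto; rewrite !length_app; simpl; lia. }
        apply app_inv_head in Ez; injection Ez as ->; auto.
    (* Outside the cone of [e] no exit is new: an initial segment of [x] covered by [s] lies
       properly below [e], so [F] already covers it. *)
    + assert (Hxex : exit_node F x).
      { split.
        - intros (s' & Hs' & Hxs'); apply Hx; exists s'; split; [now right|auto].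
        - intros v Hvx Hne; destruct (Hx' v Hvx Hne) as (s' & [<-|Hs'] & Hvs').
          + apply He.
            * destruct (prefix_total v e s) as [|H]; auto.
              destruct Hex; eauto using prefix_trans.
            * intros ->; auto.
          + exists s'; auto. }
      assert (Hav : avoids nm q x w0).
      { apply HL; auto; intros HxL'; apply HxL, in_or_app; auto. }
      apply (avoids_mono q q' x x w0 w') in Hav; eauto using prefix_refl, refines_le.
  - intros s' [<-|Hs'].
    + revert Hpos'; apply positive_mono; auto; intros y Hy.
      assert (Hry : proj1_sig r (s ++ [y])).
      { apply Hr; right; exists y; split; [auto|].
        split; [apply prefix_refl|apply Hrw, Hy]. }
      apply Hq'; auto.
    + generalize (HF s' Hs'); apply positive_mono; auto.
      intros y; now apply Href.
  - intros _; exists s; split; [now left|auto].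
Qed.

(** Stage [n] serves the word and the node with code [n], and [r] is the intersection of all stages.
    It is a condition because each of its nodes lies below a fixed split node, whose successors no
    longer change. *)
Lemma fusion : exists r : QJ J, QJ_le r p /\
  forall w, exists w', is_prefix w w' /\ avoids nm r nil w'.
Proof.
  destruct (countable_list X (ex_intro _ code code_inj)) as [ct Hct].
  destruct (countable_list bool countable_bool) as [cw Hcw].
  set (state := {st : QJ J * list (list X) |
    QJ_le (fst st) p /\ good (fst st) (snd st) /\
    forall s, In s (snd st) -> ~ J (fun y => proj1_sig (fst st) (s ++ [y]))}).
  set (R := fun n (S S' : state) =>
    let (q, F) := proj1_sig S in let (q', F') := proj1_sig S' in
    refines F q' q /\ incl F F' /\
    (forall t, ct t = n -> proj1_sig q' t -> covered F' t) /\
    (forall w, cw w = n -> exists w', is_prefix w w' /\ avoids nm q' nil w')).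
  assert (Hstep : forall n S, exists S', R n S S').
  { intros n [[q F] (Hq & Hg & HF)]; simpl in *.
    assert (exists q1, refines F q1 q /\
      forall w, cw w = n -> exists w', is_prefix w w' /\ avoids nm q1 nil w')
      as (q1 & Hq1 & Hw1).
    { destruct (classic (exists w, cw w = n)) as [[w Ew]|Hno].
      - destruct (avoid_step q F w Hq Hg) as (q1 & w' & H1 & H2 & H3).
        exists q1; split; auto; intros v Ev.
        rewrite (Hcw v w) by congruence; eauto.
      - exists q; split; [apply refines_refl|]; intros w Hw; destruct Hno; eauto. }
    assert (Hq1p : QJ_le q1 p) by eauto using QJ_le_trans, refines_le.
    assert (Hg1 : good q1 F) by apply (good_mono q q1 F (proj1 Hq1) Hg).
    assert (HF1 : forall s, In s F -> ~ J (fun y => proj1_sig q1 (s ++ [y]))).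
    { intros s Hs; generalize (HF s Hs); apply positive_mono; auto.
      intros y; now apply Hq1. }
    assert (exists q2 F2, refines F q2 q1 /\ incl F F2 /\ good q2 F2 /\
      (forall s, In s F2 -> ~ J (fun y => proj1_sig q2 (s ++ [y]))) /\
      forall t, ct t = n -> proj1_sig q2 t -> covered F2 t)
      as (q2 & F2 & Hq2 & HFF2 & Hg2 & HF2 & Ht2).
    { destruct (classic (exists t, ct t = n)) as [[t Et]|Hno].
      - destruct (split_step q1 F t Hq1p Hg1 HF1) as (q2 & F2 & H1 & H2 & H3 & H4 & H5).
        exists q2, F2; do 4 (split; auto).
        intros t' Et'; now rewrite (Hct t' t) by congruence.
      - exists q1, F; split; [apply refines_refl|].
        split; [apply incl_refl|do 2 (split; auto)].
        intros t Ht; destruct Hno; eauto. }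
    assert (H2 : QJ_le q2 p) by eauto using QJ_le_trans, refines_le.
    exists (exist _ (q2, F2) (conj H2 (conj Hg2 HF2))); simpl.
    split; [eauto using refines_trans|do 2 (split; auto)].
    intros w Hw; destruct (Hw1 w Hw) as (w' & Hww' & Hav).
    exists w'; split; auto.
    apply (avoids_mono q1 q2 nil nil w' w'); auto using prefix_refl; apply Hq2. }
  (* Nothing is fixed at first, and the only exit, the root, is listed as an exception. *)
  assert (H0 : good p nil).
  { intros w; exists w, [nil]; split; [apply prefix_refl|].
    intros [|x t] [_ Ht] HL; [destruct HL; now left|].
    destruct (Ht nil) as (s & [] & _); auto using prefix_nil; discriminate. }
  assert (HF0 : forall s, In s (@nil (list X)) -> ~ J (fun y => proj1_sig p (s ++ [y])))
    by (intros s []).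
  destruct (dependent_choice_nat R
    (exist _ (p, nil) (conj (QJ_le_refl J p) (conj H0 HF0))) Hstep) as (st & E0 & HR).
  set (q := fun n => fst (proj1_sig (st n))).
  set (F := fun n => snd (proj1_sig (st n))).
  assert (HR' : forall n, refines (F n) (q (S n)) (q n) /\ incl (F n) (F (S n)) /\
    (forall t, ct t = n -> proj1_sig (q (S n)) t -> covered (F (S n)) t) /\
    (forall w, cw w = n -> exists w', is_prefix w w' /\ avoids nm (q (S n)) nil w')).
  { intros n; specialize (HR n); unfold R, q, F in *.
    destruct (proj1_sig (st n)), (proj1_sig (st (S n))); auto. }
  assert (HFq : forall n s, In s (F n) -> ~ J (fun y => proj1_sig (q n) (s ++ [y]))).
  { intros n; apply (proj2_sig (st n)). }
  assert (Hmono : forall n k, QJ_le (q (k + n)) (q n) /\ incl (F n) (F (k + n)) /\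
    forall s y, In s (F n) -> proj1_sig (q n) (s ++ [y]) ->
                proj1_sig (q (k + n)) (s ++ [y])).
  { intros n k; induction k as [|k (IH1 & IH2 & IH3)]; simpl.
    - split; [apply QJ_le_refl|split; [apply incl_refl|auto]].
    - destruct (HR' (k + n)) as ((H1 & H2) & H3 & _).
      split; [eauto using QJ_le_trans|split; [eauto using incl_tran|auto]]. }
  assert (Hstable : forall n s y, In s (F n) -> proj1_sig (q n) (s ++ [y]) ->
    forall m, proj1_sig (q m) (s ++ [y])).
  { intros n s y Hs Hy m; destruct (le_ge_dec n m) as [Hnm|Hmn].
    - replace m with ((m - n) + n) by lia; now apply Hmono.
    - apply (Hmono m (n - m)); replace (n - m + m) with n by lia; auto. }
  assert (Hr : QJ_cond J (fun u => forall n, proj1_sig (q n) u)).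
  { split; [split|].
    - intros n; apply QJ_nil.
    - intros u v Huv Hv n; now apply (QJ_prefix J (q n) u v).
    - intros t Ht; destruct (HR' (ct t)) as (_ & _ & Hcov & _).
      destruct (Hcov t eq_refl (Ht _)) as (s & Hs & Hts).
      assert (Hpos := HFq _ s Hs).
      destruct (positive_inhabited J HJ J_empty _ Hpos) as [y Hy].
      exists s; split; [auto|split].
      (* The node [s] survives as an initial segment of one of its permanent successors. *)
      + intros m; apply (QJ_prefix J (q m) s (s ++ [y])); [apply prefix_app|].
        now apply (Hstable (S (ct t))).
      + revert Hpos; apply positive_mono; auto; intros z Hz.
        now apply (Hstable (S (ct t))). }
  exists (exist _ _ Hr); split.
  - intros u Hu; specialize (Hu 0); unfold q in Hu; now rewrite E0 in Hu.
  - intros w; destruct (HR' (cw w)) as (_ & _ & _ & Hav).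
    destruct (Hav w eq_refl) as (w' & Hw & Hw'); exists w'; split; auto.
    apply (avoids_mono (q (S (cw w))) _ nil nil w' w'); auto using prefix_refl.
    intros u Hu; apply Hu.
Qed.

(** The words avoided by [r] form a dense set, which the real cannot meet below [r]. *)
Lemma fusion_not_cohen : ~ forces_cohen (@QJ_le X J) p nm.
Proof.
  intros HC; destruct fusion as (r & Hr & Hav).
  destruct (HC (fun w => avoids nm r nil w) Hav r Hr) as (u & Hu & w & Hw & Hf).
  now apply (Hw u Hu (QJ_nil J u)).
Qed.

End Fusion.

(** * The family without members, and the equivalence *)

(* If [J] is empty then the one-node tree is an atom below every condition. *)
Lemma atomic_not_cohen : ~ J (fun _ => False) ->
  ~ @adds_cohen_real (QJ J) (@QJ_le X J).
Proof.
  intros HE (p & nm & Hreal & HC).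
  assert (Hm : QJ_cond J (fun u => u = nil)).
  { split; [split; auto|].
    - intros s t [u ->] H; now apply app_eq_nil in H.
    - intros t ->; exists nil; split; [apply prefix_refl|split; auto].
      intros H; apply HE; revert H; apply HJ; tauto. }
  set (m := exist _ _ Hm : QJ J).
  assert (Hmin : forall q, QJ_le m q) by (intros q u ->; apply QJ_nil).
  (* Lying below every condition, [m] decides all bits, so the words it does not force are dense;
     genericity would make it force one of them. *)
  set (D := fun w => ~ forces_init (@QJ_le X J) nm m w).
  assert (HD : cohen_dense D).
  { intros w; destruct (decide_val Hreal m (length w) (Hmin p)) as (r & i & _ & Hv).
    exists (w ++ [negb i]); split; [apply prefix_app|].
    intros Hf; apply forces_init_snoc in Hf as [_ Hf].
    assert (i = negb i); [|now destruct i].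
    apply (forces_val_unique Hreal m (length w)); auto.
    intros q Hq; apply Hv; eauto using QJ_le_trans. }
  destruct (HC D HD m (Hmin p)) as (r & _ & w & Hw & Hf).
  apply Hw, (forces_init_stronger (@QJ_le_trans X J) r); auto.
Qed.

End CohenReals.

Theorem theorem3p3 (X : Type) (J : (X -> Prop) -> Prop)
  (hX : countable_type X) (hJ : hereditary J) (hdom : ~ J (fun _ => True)) :
  ~ @adds_cohen_real (QJ J) (@QJ_le X J) <->
  (forall a : X -> Prop, ~ J a -> ~ katetov_ge (restr J a) NWD).
Proof.
  split.
  - intros Hno a Ha [f Hf]; apply Hno.
    (* The default [nil] off [a] is harmless, since preimages are intersected with [a]. *)
    set (F := fun x => match excluded_middle_informative (a x) with
                       | left h => f (exist _ x h) | right _ => nil end).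
    apply (katetov_adds_cohen J hJ a F Ha).
    intros b Hb; refine (hJ _ _ _ (Hf b Hb)); intros x [Hx HFx]; revert HFx.
    unfold F; destruct (excluded_middle_informative (a x)) as [h|]; [|tauto].
    intros HFx; now exists h.
  - intros Hk.
    (* By heredity, a family without the empty set has no members; its trees may have leaves, so the
       fusion is run only in the other case. *)
    destruct (classic (J (fun _ => False))) as [HE|HE].
    + destruct hX as [code Hcode].
      intros (p & nm & Hreal & HC).
      exact (fusion_not_cohen J hJ HE code Hcode p nm Hreal Hk HC).
    + now apply atomic_not_cohen.
Qed.
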